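(* If $\Phi:\mathbb R\to\mathbb R$ is a $2\pi$-periodic bounded function that is differentiable a.e., then $\mathbb U_{\Phi}(z)\to\Phi'(\arg\zeta)$ as $z\to\zeta$ for a.e. $\zeta\in\partial\mathbb D$ along all nontangential paths in $\mathbb D$ to the point $\zeta$.
   Context: $\mathbb D=\{z\in\mathbb C:|z|<1\}$; for $|\zeta|=1$, $\arg\zeta$ is the unique $\tau\in(-\pi,\pi]$ with $\zeta=e^{i\tau}$. For arbitrary functions $g,f$ on a compact interval $[a,b]$, the Riemann--Stieltjes integral $\int_a^b g\,df$ is the limit, as $\delta:=\max_k|t_k-t_{k-1}|\to0$, of the sums $\sum_{k=1}^p g(\tau_k)\,(f(t_k)-f(t_{k-1}))$ over partitions $a=t_0\le t_1\le\dots\le t_p=b$ and points $\tau_k\in[t_{k-1},t_k]$, provided a finite limit exists, uniform with respect to the partitions and the intermediate points (no monotonicity or bounded variation is assumed). The Poisson kernel is $P_r(\Theta)=\dfrac{1-r^2}{1-2r\cos\Theta+r^2}$, $0\le r<1$. For a $2\pi$-periodic bounded $\Phi:\mathbb R\to\mathbb R$ whose set of discontinuities has measure zero, the Poisson--Stieltjes integral is the Riemann--Stieltjes integral $$\mathbb U_\Phi(z):=\frac1{2\pi}\int_{-\pi}^{\pi}P_r(\vartheta-t)\,d\Phi(t),\qquad z=re^{i\vartheta},\ r<1.$$ A path in $\mathbb D$ terminating at $\zeta\in\partial\mathbb D$ is nontangential if its part in a neighborhood of $\zeta$ lies inside an angle in $\mathbb D$ with vertex at $\zeta$. *)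

(* Defs.v *)
From mathcomp Require Import all_boot all_order all_algebra.
From mathcomp Require Import all_classical all_reals all_analysis.
From mathcomp Require Import complex.

Set Implicit Arguments.
Unset Strict Implicit.
Unset Printing Implicit Defensive.

Import Order.TTheory GRing.Theory Num.Theory numFieldNormedType.Exports.

Local Open Scope classical_set_scope.
Local Open Scope ring_scope.
Local Open Scope complex_scope.

(* The regular-module alias R[i]^o carries the norm topology of R[i]; it is
   used wherever a limit or continuity in the complex plane is meant. *)

Definition expi {R : realType} (t : R) : R[i] := cos t +i* sin t.

(* The real-valued modulus: the norm `|z| of R[i] is itself an element of
   R[i], with zero imaginary part. *)
Definition modulus {R : realType} (z : R[i]) : R := complex.Re `|z|.

(* For z <> 0, the unique t in ]-pi, pi] with z = |z| e^(it); for z = 0 every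
   t qualifies and the value is irrelevant, since P_0 is constant. *)
Definition carg {R : realType} (z : R[i]) : R :=
  xget 0 [set t : R | t \in `]- pi, pi] /\ z = (modulus z)%:C * expi t].

Definition unit_disc {R : realType} : set R[i] := [set z | modulus z < 1].

(* The map t |-> e^(it) identifies ]-pi, pi] with the unit circle and Lebesgue
   measure with arc length. *)
Definition circle_ae {R : realType} (P : R[i] -> Prop) : Prop :=
  {ae (@lebesgue_measure R), forall t, t \in `]- pi, pi] -> P (expi t)}.

(* The inequalities on tau make t nondecreasing on [0, p]. *)
Definition is_RS_integral {R : realType} (g f : R -> R) (a b l : R) : Prop :=
  forall eps : R, 0 < eps -> exists2 delta : R, 0 < delta &
    forall (p : nat) (t tau : nat -> R),
      t 0%N = a -> t p = b ->
      (forall k, (k < p)%N -> t k <= tau k <= t k.+1) ->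
      (forall k, (k < p)%N -> t k.+1 - t k < delta) ->
      `| \sum_(k < p) g (tau k) * (f (t k.+1) - f (t k)) - l | < eps.

Definition RS_integrable {R : realType} (g f : R -> R) (a b : R) : Prop :=
  exists l, is_RS_integral g f a b l.

Definition RS_integral {R : realType} (g f : R -> R) (a b : R) : R :=
  xget 0 [set l | is_RS_integral g f a b l].

Definition poisson_kernel {R : realType} (r Theta : R) : R :=
  (1 - r ^+ 2) / (1 - 2 * r * cos Theta + r ^+ 2).

Definition poisson_at {R : realType} (z : R[i]) (t : R) : R :=
  poisson_kernel (modulus z) (carg z - t).

Definition poisson_stieltjes {R : realType} (Phi : R -> R) (z : R[i]) : R :=
  (2 * pi)^-1 * RS_integral (poisson_at z) Phi (- pi) pi.

Definition angle {R : realType} (zeta : R[i]) (alpha beta : R) : set R[i] :=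
  [set z | exists rho phi : R,
    [/\ 0 < rho, alpha < phi < beta & z = zeta + rho%:C * expi phi]].

(* A path in the disc terminating at zeta is parametrized by [0, 1[. *)
Definition path_to {R : realType} (zeta : R[i]) (gamma : R -> R[i]) : Prop :=
  [/\ {within `[0, 1[, continuous (gamma : R -> R[i]^o)},
      gamma @` `[0, 1[ `<=` unit_disc
    & gamma s @[s --> (1 : R)^'-] --> (zeta : R[i]^o)].

(* An unbounded angle never lies in the disc: "an angle in the disc with
   vertex zeta" is one whose part near zeta lies in the disc. *)
Definition nontangential {R : realType} (zeta : R[i]) (gamma : R -> R[i]) :
    Prop :=
  path_to zeta gamma /\
  exists (alpha beta : R) (N : set R[i]),
    [/\ nbhs (zeta : R[i]^o) N,
        angle zeta alpha beta `&` N `<=` unit_disc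
      & gamma @` `[0, 1[ `&` N `<=` angle zeta alpha beta].

(* Main.v *)
(* Integration by parts turns U_Phi(z) into - (2 pi)^-1 \int Phi(t) g'(t) dt,
   where g(t) = P_r(theta - t); the boundary terms cancel by periodicity.  As
   Phi is only measurable for the completed Lebesgue measure, it is replaced
   under the integral by its lower semicontinuous envelope, which is Borel and
   agrees with Phi wherever Phi is continuous.

   If Phi is differentiable at t0 with derivative l, subtract
   Phi(t0) + l sin(t - t0), whose Poisson-Stieltjes integral is exactly
   l r cos(theta - t0).  The difference h satisfies, for every e > 0,
   |h(t)| <= e c + C c^4 where c = |e^(it) - e^(it0)|.  With q = |e^(it) - z|,
   one has |g'(t)| <= 2 (1 - r^2) / q^3, and c <= (1 + K) q as soon as
   |z - e^(it0)| <= K (1 - r), which holds near the end of a nontangential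
   path.  Hence |h g'| is at most 2 e (1 + K) g + 4 C (1 + K)^4 (1 - r^2), and
   \int g = 2 pi. *)

Require Import Defs.
From mathcomp Require Import all_boot all_order all_algebra.
From mathcomp Require Import all_classical all_reals all_analysis.
From mathcomp Require Import measurable_realfun complex.
From mathcomp Require Import ring lra.

Set Implicit Arguments.
Unset Strict Implicit.
Unset Printing Implicit Defensive.

Import Order.TTheory GRing.Theory Num.Theory numFieldNormedType.Exports.

Local Open Scope classical_set_scope.
Local Open Scope ring_scope.
Local Open Scope complex_scope.

(** * Lower semicontinuous envelope *)

Section lower_envelope.
Context {R : realType}.
Implicit Types f u : R -> R.

Definition lower_envelope f (x : R) : R :=
  sup [set m | \forall y \near x, m <= f y].

Lemma lower_envelope_nonempty f (M x : R) : (forall y, `|f y| <= M) ->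
  [set m | \forall y \near x, m <= f y] !=set0.
Proof.
move=> fM; exists (- M) => /=; near=> y.
by have := fM y; rewrite ler_norml => /andP[].
Unshelve. all: by end_near. Qed.

Lemma lower_envelope_le f (M x : R) : (forall y, `|f y| <= M) ->
  lower_envelope f x <= f x.
Proof.
move=> fM; apply: ge_sup; last by move=> m /= /(@nbhs_singleton _ x).
exact: lower_envelope_nonempty fM.
Qed.

Lemma lower_envelope_ub f (M x m : R): (forall y, `|f y| <= M) ->
  (\forall y \near x, m <= f y) -> m <= lower_envelope f x.
Proof.
move=> fM mf; apply: ub_le_sup => //; exists (f x) => k /=.
by move/(@nbhs_singleton _ x).
Qed.

Lemma lower_envelope_ge f u (M x : R) : (forall y, `|f y| <= M) ->
  {for x, continuous u} -> (forall y, u y <= f y) -> u x <= lower_envelope f x.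
Proof.
move=> fM cu uf; apply/ler_addgt0Pr => e e0.
rewrite -lerBlDr; apply: (lower_envelope_ub fM).
have /cvgrPdist_lt/(_ _ e0) := cu.
apply: filterS => y; rewrite ltr_distlC => /andP[+ _] => uxy.
by apply: le_trans (uf y); apply: ltW.
Qed.

Lemma lower_envelope_id f (M x : R) : (forall y, `|f y| <= M) ->
  {for x, continuous f} -> lower_envelope f x = f x.
Proof.
move=> fM cf; apply/eqP; rewrite eq_le (lower_envelope_le _ fM).
exact: lower_envelope_ge fM cf _.
Qed.

(** The envelope dominates every continuous minorant of [f], here [u - v], and the upper bound
    follows from its lying below [f]. Estimates on [Phi] thus pass to its envelope at every point,
    not only at points of continuity. *)
Lemma lower_envelope_dist f u v (M x : R) : (forall y, `|f y| <= M) ->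
  continuous u -> continuous v -> (forall y, `|f y - u y| <= v y) ->
  `|lower_envelope f x - u x| <= v x.
Proof.
move=> fM cu cv fuv; rewrite ler_distl; apply/andP; split.
  apply: (@lower_envelope_ge f (u \- v) M) => //=.
    exact: continuousB (cu x) (cv x).
  by move=> y; have := fuv y; rewrite ler_distl => /andP[].
apply: le_trans (lower_envelope_le x fM) _.
by have := fuv x; rewrite ler_distl => /andP[].
Qed.

Lemma lower_envelope_norm f (M x : R) : (forall y, `|f y| <= M) ->
  `|lower_envelope f x| <= M.
Proof.
move=> fM.
rewrite -[lower_envelope f x]subr0.
apply: (@lower_envelope_dist f (cst 0) (cst M) M) => // [||y].
- by move=> ?; exact: cst_continuous.
- by move=> ?; exact: cst_continuous.
- by rewrite subr0.
Qed.

(** Superlevel sets are open: a lower bound [m > a] valid near [x] is still valid near every point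
    close to [x]. *)
Lemma measurable_lower_envelope f (M : R) : (forall y, `|f y| <= M) ->
  measurable_fun setT (lower_envelope f).
Proof.
move=> fM; apply/measurable_EFinP; apply: lower_semicontinuous_measurable.
move=> x a afx; have : (a%:E < (lower_envelope f x)%:E)%E := afx.
rewrite lte_fin => /sup_gt[]; first exact: lower_envelope_nonempty fM.
move=> m /= mf am; exists [set y | \forall z \near y, m <= f z].
  by move/(@nbhs_interior _ x): mf.
move=> y /= my; apply: (@lt_le_trans _ _ m%:E).
  by rewrite lte_fin.
by rewrite /= lee_fin; exact: lower_envelope_ub fM my.
Qed.

End lower_envelope.

(** * Riemann-Stieltjes integration by parts *)

Section step_function.
Context {R : realType}.
Implicit Types (s c : nat -> R).

(** For nondecreasing knots the half-open cells are disjoint, so at most one term is nonzero at each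
    point; a repeated knot gives an empty cell. *)
Definition step s c (m : nat) (x : R) : R :=
  \sum_(k < m) c k * \1_(`]s k, s k.+1]%classic) x.

Lemma step_outside s c m x : (forall k, (k < m)%N -> s k <= s k.+1) ->
  s m < x -> step s c m x = 0.
Proof.
elim: m => [|m IH] sm smx; first by rewrite /step big_ord0.
have ? : s m <= s m.+1 by apply: sm.
rewrite /step big_ord_recr /= -/(step s c m x) IH ?(le_lt_trans _ smx)//; last first.
  by move=> k km; apply: sm; exact: ltnW.
by rewrite indicE memNset ?mulr0 ?addr0//= in_itv/= => /andP[_]; rewrite leNgt smx.
Qed.

Lemma step_inside s c m x : (forall k, (k < m)%N -> s k <= s k.+1) ->
  s 0%N < x <= s m ->
  exists2 j, (j < m)%N & s j < x <= s j.+1 /\ step s c m x = c j.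
Proof.
elim: m => [|m IH] sm; first by move=> /andP[/lt_le_trans/[apply]]; rewrite ltxx.
have sm' k : (k < m)%N -> s k <= s k.+1 by move=> km; apply: sm; exact: ltnW.
move=> /andP[x0 xm]; have [xsm|smx] := leP x (s m).
  have [||j jm [xj stepj]] := IH; [by []|by rewrite x0|].
  exists j; first exact: ltnW.
  split=> //; rewrite /step big_ord_recr /= -/(step s c m x) stepj.
  by rewrite indicE memNset ?mulr0 ?addr0//= in_itv/= ltNge xsm.
exists m => //; split; first by rewrite smx.
rewrite /step big_ord_recr /= -/(step s c m x) step_outside// add0r.
by rewrite indicE mem_set ?mulr1//= in_itv/= smx.
Qed.

Lemma measurable_step s c m : measurable_fun setT (step s c m).
Proof.
rewrite /step; apply: measurable_sum => k.
by apply: measurable_funM => //; exact: measurable_indic.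
Qed.

End step_function.

(** * Integrals of step functions against a derivative *)

Section integral_step.
Context {R : realType}.
Local Notation mu := (@lebesgue_measure R).
Implicit Types (g dg : R -> R).

Lemma Rintegral_derive (a b : R) g dg : a <= b ->
  (forall x : R, is_derive x 1 g (dg x)) -> continuous dg ->
  \int[mu]_(x in `[a, b]) dg x = g b - g a.
Proof.
rewrite le_eqVlt => /predU1P[<- _ _|ab gE dgc].
  by rewrite set_itv1 Rintegral_set1 subrr.
have gc : continuous g.
  move=> x; apply: differentiable_continuous; apply/derivable1_diffP.
  by have [] := gE x.
rewrite /Rintegral (@continuous_FTC2 _ dg g)//.
- by apply: continuous_subspaceT => x; exact: dgc.
- split.
  + by move=> x _; have [] := gE x.
  + by apply: cvg_at_right_filter; exact: gc.
  + by apply: cvg_at_left_filter; exact: gc.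
- by move=> x _; rewrite derive1E; have [_ ->] := gE x.
Qed.

Lemma continuous_integrable_itv (a b : R) g : continuous g ->
  mu.-integrable `[a, b] (EFin \o g).
Proof.
move=> gc; apply: continuous_compact_integrable; first exact: segment_compact.
by apply: continuous_subspaceT => x; exact: gc.
Qed.

Lemma integrable_bounded_mul (a b : R) (f : R -> R) (M : R) g :
  measurable_fun setT f -> (forall x, `|f x| <= M) -> continuous g ->
  mu.-integrable `[a, b] (EFin \o (f \* g)).
Proof.
move=> mf fM gc.
apply: (@le_integrable _ _ _ mu _ _ _ (EFin \o (fun x => M * `|g x|))) => //.
- apply/measurable_EFinP; apply: measurable_funTS.
  by apply: measurable_funM => //; exact: continuous_measurable_fun.
- move=> x _ /=; rewrite lee_fin normrM [leRHS]ger0_norm ?ler_wpM2r//.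
  by rewrite mulr_ge0// (le_trans _ (fM 0)).
- apply: continuous_integrable_itv => x.
  by apply: cvgM; [exact: cvg_cst|apply: cvg_norm; exact: gc].
Qed.

Lemma indic_norm_le1 (A : set R) (x : R) : `|\1_A x : R| <= 1.
Proof. by rewrite indicE; case: (x \in A); rewrite ?normr1 ?normr0. Qed.

Lemma step_norm (s c : nat -> R) m x :
  `|step s c m x| <= \sum_(k < m) `|c k|.
Proof.
apply: le_trans (ler_norm_sum _ _ _) _; apply: ler_sum => k _.
by rewrite normrM ler_piMr// indic_norm_le1.
Qed.

(** The fundamental theorem of calculus applies on each cell, since half-open and closed cells have
    the same integral. *)
Lemma Rintegral_step (a b : R) g dg (s c : nat -> R) m :
  (forall x : R, is_derive x 1 g (dg x)) -> continuous dg ->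
  (forall k, (k < m)%N -> [/\ a <= s k, s k <= s k.+1 & s k.+1 <= b]) ->
  \int[mu]_(x in `[a, b]) (step s c m x * dg x) =
  \sum_(k < m) c k * (g (s k.+1) - g (s k)).
Proof.
move=> gE dgc; elim: m => [|m IH] sm.
  rewrite big_ord0; under eq_Rintegral do rewrite /step big_ord0 mul0r.
  by rewrite Rintegral_cst// mul0r.
rewrite big_ord_recr -IH /=; last by move=> k km; apply: sm; exact: ltnW.
have [am smm mb] := sm m (ltnSn m).
have int1 : mu.-integrable `[a, b]
    (EFin \o (\1_(`]s m, s m.+1]) \* dg : R -> R)).
  apply: (@integrable_bounded_mul _ _ _ 1) => //.
  by move=> x; exact: indic_norm_le1.
under eq_Rintegral do
  rewrite /step big_ord_recr /= -/(step s c m _) mulrDl -mulrA.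
rewrite RintegralD//.
- congr (_ + _); rewrite RintegralZl//; congr (_ * _).
  transitivity (\int[mu]_(x in `[a, b]) (dg \_ `]s m, s m.+1]) x).
    by apply: eq_Rintegral => x _; rewrite patch_indic /= mulrC.
  rewrite -Rintegral_mkcondr setIidr; last first.
    apply: subset_itvScc; rewrite bnd_simp//.
  rewrite Rintegral_itv_obnd_cbnd; first exact: Rintegral_derive.
  apply: (integrableS _ _ _ (@continuous_integrable_itv (s m) (s m.+1) dg dgc)) => //.
  exact: subset_itv_oc_cc.
- apply: integrable_bounded_mul => //; first exact: measurable_step.
  by move=> x; exact: step_norm.
- rewrite (_ : _ \o _ = fun x =>
    ((c m)%:E * (\1_(`]s m, s m.+1]) x * dg x)%:E)%E); last first.
    by apply/funext => x /=; rewrite EFinM.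
  exact: (integrableZl _ (c m) int1).
Qed.

End integral_step.

(** * From tagged sums to a Lebesgue integral *)

Section riemann_stieltjes_parts.
Context {R : realType}.
Local Notation mu := (@lebesgue_measure R).
Implicit Types (a b d : R) (f g dg : R -> R) (t tau : nat -> R) (p : nat).

(* The tags tau become the knots of a partition of [a, b] for which the old
   knots t 0, ..., t p are tags. *)
Definition dual_knots a b p tau (k : nat) : R :=
  if k is k'.+1 then if (k' < p)%N then tau k' else b else a.

(** Abel summation, valid for arbitrary sequences; the first and last dual knots, [a] and [b],
    produce the boundary terms. *)
Lemma sum_by_parts a b p f g t tau :
  \sum_(k < p) g (tau k) * (f (t k.+1) - f (t k)) =
  g b * f (t p) - g a * f (t 0%N) -
  \sum_(k < p.+1) f (t k) *
    (g (dual_knots a b p tau k.+1) - g (dual_knots a b p tau k)).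
Proof.
pose A := \sum_(k < p) f (t k) * g (tau k).
pose B := \sum_(k < p) f (t k.+1) * g (tau k).
have -> : \sum_(k < p) g (tau k) * (f (t k.+1) - f (t k)) = B - A.
  by rewrite -sumrB; apply: eq_bigr => k _; ring.
have -> : \sum_(k < p.+1) f (t k) *
      (g (dual_knots a b p tau k.+1) - g (dual_knots a b p tau k)) =
    (A + f (t p) * g b) - (f (t 0%N) * g a + B).
  under eq_bigr do rewrite mulrBr.
  rewrite sumrB big_ord_recr [X in _ - X]big_ord_recl /= ltnn.
  congr (_ + _ - (_ + _)); apply: eq_bigr => k _.
    by rewrite (ltn_ord k).
  by rewrite /bump /= add1n (ltn_ord k).
ring.
Qed.

Lemma partition_bounds a b p t : t 0%N = a -> t p = b ->
  (forall k, (k < p)%N -> t k <= t k.+1) ->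
  forall k, (k <= p)%N -> a <= t k <= b.
Proof.
move=> t0 tp tS k kp; apply/andP; split.
  elim: k kp => [|k IH] kp; first by rewrite t0.
  by apply: le_trans (tS _ kp); apply: IH; exact: ltnW.
have tD m : (k + m <= p)%N -> t k <= t (k + m)%N.
  elim: m => [|m IH]; first by rewrite addn0.
  by rewrite addnS => kmp; apply: le_trans (IH (ltnW kmp)) (tS _ kmp).
by rewrite -tp -(subnKC kp) tD// subnKC.
Qed.

(** For interior [k], [tau (k - 1)] and [t k] share one old cell, [t k] and [tau k] the next, so the
    mesh bound controls both gaps. At [k = 0] the left gap is zero, at [k = p] the right one. *)
Lemma dual_knotsP a b p t tau d : 0 < d -> t 0%N = a -> t p = b ->
  (forall k, (k < p)%N -> t k <= tau k <= t k.+1) ->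
  (forall k, (k < p)%N -> t k.+1 - t k < d) ->
  forall k, (k < p.+1)%N ->
  let s := dual_knots a b p tau in
  [/\ a <= s k, s k <= t k <= s k.+1, s k.+1 <= b
    & t k - s k < d /\ s k.+1 - t k < d].
Proof.
move=> d0 t0 tp ttau td k; rewrite ltnS => kp s.
have tS i : (i < p)%N -> t i <= t i.+1.
  by move=> /ttau /andP[]; exact: le_trans.
have tb := partition_bounds t0 tp tS.
have [skt skd ask] : [/\ s k <= t k, t k - s k < d & a <= s k].
  rewrite /s; case: k kp => [_|k kp] /=; first by rewrite t0 subrr.
  rewrite kp; have /andP[h1 h2] := ttau _ kp; have := td _ kp => h3.
  by split=> //; [lra|have /andP[+ _] := tb _ (ltnW kp); lra].
have [tsk tsd skb] : [/\ t k <= s k.+1, s k.+1 - t k < d & s k.+1 <= b].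
  rewrite /s /=; case: ifPn => [kp'|].
    have /andP[h1 h2] := ttau _ kp'; have := td _ kp' => h3.
    by split=> //; [lra|have /andP[_ +] := tb _ kp'; lra].
  rewrite -leqNgt => pk; have -> : k = p by apply/eqP; rewrite eqn_leq kp.
  by rewrite tp subrr.
by split=> //; rewrite skt.
Qed.

(** The dual knots turn a tagged sum into boundary terms minus the integral of a step function times
    [dg]. As the mesh shrinks, the step functions converge boundedly to [f] at its points of
    continuity. *)
Lemma is_RS_integral_parts a b f (M : R) g dg : a <= b ->
  (forall x, `|f x| <= M) ->
  {ae mu, forall x, {for x, continuous f}} ->
  (forall x : R, is_derive x 1 g (dg x)) -> continuous dg ->
  is_RS_integral g f a b
    (g b * f b - g a * f a - \int[mu]_(x in `[a, b]) (lower_envelope f x * dg x)).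
Proof.
(* Dominated convergence concerns sequences, so failure of the uniform limit is turned into a
   sequence of partitions with mesh below [1 / (n + 1)] and sums at least [eps] away. *)
move=> ab fM fc gE dgc eps e0; apply: contrapT => noD.
pose d n : R := n.+1%:R^-1.
have d0 n : 0 < d n by rewrite invr_gt0.
have : forall n : nat, exists P : nat * (nat -> R) * (nat -> R),
    [/\ P.1.2 0%N = a, P.1.2 P.1.1 = b,
      forall k, (k < P.1.1)%N -> P.1.2 k <= P.2 k <= P.1.2 k.+1,
      forall k, (k < P.1.1)%N -> P.1.2 k.+1 - P.1.2 k < d n
    & eps <= `|\sum_(k < P.1.1) g (P.2 k) * (f (P.1.2 k.+1) - f (P.1.2 k)) -
        (g b * f b - g a * f a -
         \int[mu]_(x in `[a, b]) (lower_envelope f x * dg x))|].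
  move=> n; apply: contrapT => noP; apply: noD; exists (d n) => //.
  move=> p t tau t0 tp ttau td; rewrite ltNge; apply/negP => le.
  by apply: noP; exists (p, t, tau).
move=> /choice[P PP].
pose p n := (P n).1.1; pose t n := (P n).1.2; pose tau n := (P n).2.
pose s n := dual_knots a b (p n) (tau n).
pose F n := step (s n) (f \o t n) (p n).+1.
have sP n k : (k < (p n).+1)%N ->
  [/\ a <= s n k, s n k <= t n k <= s n k.+1, s n k.+1 <= b
    & t n k - s n k < d n /\ s n k.+1 - t n k < d n].
  by have [t0 tp ttau td _] := PP n; apply: dual_knotsP.
have sS n k : (k < (p n).+1)%N -> s n k <= s n k.+1.
  by move=> /sP[_ /andP[+ +] _ _]; exact: le_trans.
(* This yields both the pointwise convergence and the bound by [M]. The point [a] is excluded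
   because cells are open on the left. *)
have Fx n x : a < x <= b -> exists2 y, F n x = f y & `|x - y| < d n.
  move=> xab; have [|j jp [/andP[h1 h2] Fj]] := step_inside (f \o t n) (sS n) (x := x).
    by rewrite /s /= ltnn.
  exists (t n j) => //; have [_ /andP[h3 h4] _ [h5 h6]] := sP _ _ jp.
  by rewrite ltr_distl; apply/andP; split; lra.
have SE n : \sum_(k < p n) g (tau n k) * (f (t n k.+1) - f (t n k)) =
    g b * f b - g a * f a - \int[mu]_(x in `[a, b]) (F n x * dg x).
  have [t0 tp _ _ _] := PP n.
  rewrite (@Rintegral_step _ a b g dg)//; last first.
    by move=> k kp; have [? _ ? _] := sP _ _ kp; split=> //; exact: sS.
  by rewrite (sum_by_parts a b) -/(s n) /t tp t0.
have mE := measurable_lower_envelope fM.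
have EM x : `|lower_envelope f x| <= M by exact: lower_envelope_norm.
have iE : mu.-integrable `[a, b] (EFin \o (lower_envelope f \* dg)).
  exact: integrable_bounded_mul mE EM dgc.
have mF n : measurable_fun setT (F n) by exact: measurable_step.
have iF n : mu.-integrable `[a, b] (EFin \o (F n \* dg)).
  by apply: integrable_bounded_mul dgc => // x; exact: step_norm.
have [||||||_ _] := @dominated_convergence _ _ _ mu `]a, b] _
    (fun n x => (F n x * dg x)%:E) (fun x => (lower_envelope f x * dg x)%:E)
    (fun x => (M * `|dg x|)%:E).
- by [].
- move=> n; apply/measurable_EFinP; apply: measurable_funTS.
  by apply: measurable_funM; [exact: mF|exact: continuous_measurable_fun dgc].
- apply/measurable_EFinP; apply: measurable_funTS.
  by apply: measurable_funM; [exact: mE|exact: continuous_measurable_fun dgc].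
- apply: (@filterS _ _ (ae_filter_ringOfSetsType mu) _ _ _ fc) => x fcx.
  rewrite /= in_itv/= => xab.
  apply: cvg_EFin; first exact: nearW.
  apply: cvgM; last exact: cvg_cst.
  rewrite (lower_envelope_id fM fcx).
  apply/cvgrPdist_lt => e e1.
  have /cvgrPdist_lt/(_ _ e1)/nbhs_ballP[r /= r0 rf] := fcx.
  have [N _ NP] := near_infty_natSinv_lt (PosNum r0).
  exists N => // n /= Nn; have [y -> xy] := Fx n x xab.
  by apply: rf; rewrite /ball/= (lt_trans xy)//; exact: NP.
- have cMdg : continuous (fun x => M * `|dg x|).
    by move=> x; apply: cvgM; [exact: cvg_cst|apply: cvg_norm; exact: dgc].
  apply: (integrableS _ _ _ (@continuous_integrable_itv _ a b _ cMdg)) => //.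
  exact: subset_itv_oc_cc.
- apply: aeW => x n; rewrite /= in_itv/= => xab.
  by rewrite lee_fin normrM ler_wpM2r//; have [y -> _] := Fx n x xab.
have EI (h : R -> R) : mu.-integrable `[a, b] (EFin \o h) ->
    (\int[mu]_(x in `]a, b]) (h x)%:E)%E = (\int[mu]_(x in `[a, b]) h x)%:E.
  move=> ih; have ih' : mu.-integrable `]a, b] (EFin \o h).
    by apply: integrableS ih => //; exact: subset_itv_oc_cc.
  by rewrite -Rintegral_itv_obnd_cbnd// /Rintegral fineK//; exact: integrable_fin_num.
rewrite (EI _ iE); under eq_fun do rewrite (EI _ (iF _)).
move=> /fine_cvg/cvgrPdist_lt/(_ _ e0)[N _ /(_ N (leqnn N))] /=.
have [_ _ _ _] := PP N; rewrite -/(p N) -/(t N) -/(tau N) SE.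
set I := Rintegral _ _ _; set J := Rintegral _ _ _ => le lt.
move: le; rewrite [X in `|X|](_ : _ = J - I); last by ring.
by rewrite leNgt lt.
Qed.

End riemann_stieltjes_parts.

(** * Uniqueness of the Riemann-Stieltjes integral *)

Section riemann_stieltjes_unique.
Context {R : realType}.
Implicit Types (a b l : R) (f g : R -> R).

(** A fine enough uniform partition meets both mesh conditions, and its sum would be closer than
    half of [|l1 - l2|] to both values. *)
Lemma is_RS_integral_unique f g a b l1 l2 : a <= b ->
  is_RS_integral g f a b l1 -> is_RS_integral g f a b l2 -> l1 = l2.
Proof.
move=> ab i1 i2; apply/eqP; rewrite -subr_eq0 -normr_le0 leNgt; apply/negP => l12.
have e0 : 0 < `|l1 - l2| / 2 by rewrite divr_gt0.
have [d1 d10 {}i1] := i1 _ e0; have [d2 d20 {}i2] := i2 _ e0.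
have d0 : 0 < Num.min d1 d2 by rewrite lt_min d10.
pose n := Num.bound ((b - a) / Num.min d1 d2).
pose t (k : nat) := a + (b - a) * (k%:R / n.+1%:R).
have tn : t n.+1 = b by rewrite /t divff// mulr1 addrC subrK.
have tS k : t k.+1 - t k = (b - a) / n.+1%:R by rewrite /t -natr1; ring.
have tSmin k : t k.+1 - t k < Num.min d1 d2.
  rewrite tS ltr_pdivrMr// mulrC -ltr_pdivrMr// (lt_trans (archi_boundP _))//.
    by rewrite divr_ge0 ?subr_ge0// ltW.
  by rewrite ltr_nat.
have tle k : t k <= t k <= t k.+1.
  by rewrite lexx -subr_ge0 tS divr_ge0// subr_ge0.
have t0 : t 0%N = a by rewrite /t mul0r mulr0 addr0.
have S1 := i1 n.+1 t t t0 tn (fun k _ => tle k) _.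
have S2 := i2 n.+1 t t t0 tn (fun k _ => tle k) _.
have : `|l1 - l2| < `|l1 - l2| / 2 + `|l1 - l2| / 2.
  apply: le_lt_trans (ler_distD _ _ _) (ltrD _ (S2 _)).
    rewrite distrC; apply: S1 => k _.
    by rewrite (lt_le_trans (tSmin k))// ge_min lexx.
  by move=> k _; rewrite (lt_le_trans (tSmin k))// ge_min lexx orbT.
by rewrite -splitr ltxx.
Qed.

Lemma RS_integralE f g a b l : a <= b ->
  is_RS_integral g f a b l -> RS_integral g f a b = l.
Proof.
move=> ab il; apply: xget_unique => // l' il'.
exact: is_RS_integral_unique ab il' il.
Qed.

End riemann_stieltjes_unique.

(** * Poisson kernel *)

Section poisson_kernel.
Context {R : realType}.
Implicit Types (r x t theta : R).

Definition poisson_den r x : R := 1 - 2 * r * cos x + r ^+ 2.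

Lemma poisson_den_ge r x : 0 <= r -> (1 - r) ^+ 2 <= poisson_den r x.
Proof.
move=> r0; rewrite /poisson_den; have := ler_wpM2l r0 (cos_le1 x); lra.
Qed.

Lemma poisson_den_gt0 r x : 0 <= r < 1 -> 0 < poisson_den r x.
Proof.
move=> /andP[r0 r1]; apply: lt_le_trans (poisson_den_ge x r0).
by rewrite exprn_gt0// subr_gt0.
Qed.

Lemma is_derive_Nshift theta t : is_derive t 1 (fun u => theta - u) (-1 : R).
Proof.
have h := is_deriveB (is_derive_cst theta t 1) (is_derive_id t 1).
by apply: is_derive_eq h _; rewrite sub0r.
Qed.

Lemma is_derive_cosB theta t :
  is_derive t 1 (fun u => cos (theta - u)) (sin (theta - t)).
Proof.
have h := @is_derive1_comp _ cos (fun u => theta - u) t _ _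
  (is_derive_cos _) (is_derive_Nshift theta t).
by apply: is_derive_eq h _; rewrite mulrN1 opprK.
Qed.

Lemma is_derive_sinB theta t :
  is_derive t 1 (fun u => sin (theta - u)) (- cos (theta - t)).
Proof.
have h := @is_derive1_comp _ sin (fun u => theta - u) t _ _
  (is_derive_sin _) (is_derive_Nshift theta t).
by apply: is_derive_eq h _; rewrite mulrN1.
Qed.

Lemma is_derive_poisson_den r theta t :
  is_derive t 1 (fun u => poisson_den r (theta - u)) (- (2 * r * sin (theta - t))).
Proof.
have ? := is_derive_cosB theta t.
rewrite /poisson_den; apply: is_derive_eq.
rewrite /= /GRing.scale/=; ring.
Qed.

Definition dpoisson r theta t : R :=
  (1 - r ^+ 2) * (2 * r * sin (theta - t)) / poisson_den r (theta - t) ^+ 2.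

Lemma is_derive_poisson r theta t : 0 <= r < 1 ->
  is_derive t 1 (fun u => poisson_kernel r (theta - u)) (dpoisson r theta t).
Proof.
move=> r01; have D0 := lt0r_neq0 (poisson_den_gt0 (theta - t) r01).
have h := @is_deriveV _ (fun u => poisson_den r (theta - u)) _ _ _ D0
  (is_derive_poisson_den r theta t).
rewrite /poisson_kernel; apply: is_derive_eq.
rewrite /= /GRing.scale/= /dpoisson; field.
exact: D0.
Qed.

Lemma continuous_dpoisson r theta : 0 <= r < 1 -> continuous (dpoisson r theta).
Proof.
move=> r01 t.
have cT : {for t, continuous (fun u => theta - u)}.
  by apply: cvgB; [exact: cvg_cst|exact: cvg_id].
have cS : {for t, continuous (fun u => sin (theta - u))}.
  exact: continuous_comp cT (@continuous_sin _ _).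
have cC : {for t, continuous (fun u => cos (theta - u))}.
  exact: continuous_comp cT (@continuous_cos _ _).
rewrite /dpoisson; apply: cvgM.
  by apply: cvgM; [exact: cvg_cst|apply: cvgM; [exact: cvg_cst|exact: cS]].
apply: cvgV; first by rewrite expf_neq0// lt0r_neq0// poisson_den_gt0.
rewrite /poisson_den; apply: (@cvg_comp _ _ _ _ (fun x => x ^+ 2));
  last exact: exprn_continuous.
apply: cvgD; last exact: cvg_cst.
by apply: cvgB; [exact: cvg_cst|apply: cvgM; [exact: cvg_cst|exact: cC]].
Qed.

(* The arctangent is - arg (1 - r e^(i (theta - t))), the imaginary part of
   - log (1 - r w) = \sum_n (r w)^n / n at w = e^(i (theta - t)). *)
Definition poisson_prim r theta t : R :=
  t - 2 * atan (r * sin (theta - t) / (1 - r * cos (theta - t))).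

Lemma is_derive_poisson_prim r theta t : 0 <= r < 1 ->
  is_derive t 1 (poisson_prim r theta) (poisson_kernel r (theta - t)).
Proof.
move=> r01; have /andP[r0 r1] := r01.
have C0 : 1 - r * cos (theta - t) != 0.
  by apply: lt0r_neq0; have := ler_wpM2l r0 (cos_le1 (theta - t)); lra.
have dC : is_derive t 1 (fun u => 1 - r * cos (theta - u)) (- (r * sin (theta - t))).
  have ? := is_derive_cosB theta t; apply: is_derive_eq.
  by rewrite /GRing.scale/=; ring.
have dV := @is_deriveV _ (fun u => 1 - r * cos (theta - u)) t _ _ C0 dC.
have dq : is_derive t 1 (fun u => r * sin (theta - u) / (1 - r * cos (theta - u)))
    ((r ^+ 2 - r * cos (theta - t)) / (1 - r * cos (theta - t)) ^+ 2).
  have ? := is_derive_sinB theta t; apply: is_derive_eq.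
  rewrite /GRing.scale/=.
  have -> : r ^+ 2 = r ^+ 2 * (cos (theta - t) ^+ 2 + sin (theta - t) ^+ 2).
    by rewrite cos2Dsin2 mulr1.
  by field.
have da := @is_derive1_comp _ atan _ t _ _ (is_derive1_atan _) dq.
rewrite /poisson_prim; apply: is_derive_eq.
rewrite /GRing.scale/= /poisson_kernel.
have D0 := lt0r_neq0 (poisson_den_gt0 (theta - t) r01).
move: C0 D0 (cos2Dsin2 (theta - t)); rewrite /poisson_den.
set c := cos _; set s := sin _ => C0 D0 cs.
have E : (1 - r * c) ^+ 2 + (r * s) ^+ 2 = 1 - 2 * r * c + r ^+ 2.
  rewrite [r ^+ 2 in RHS](_ : _ = r ^+ 2 * (c ^+ 2 + s ^+ 2)); last first.
    by rewrite cs mulr1.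
  ring.
(* The denominator in the derivative of the arctangent is |1 - r e^(i (theta - t))|^2 divided by the
   square of [1 - r * c]. *)
have -> : 1 + (r * s / (1 - r * c)) ^+ 2 =
    (1 - 2 * r * c + r ^+ 2) / (1 - r * c) ^+ 2 by rewrite -E; field.
by field; rewrite D0 C0.
Qed.

Lemma sinB_pi x : sin (x - pi) = - sin x :> R.
Proof. by rewrite sinB cospi sinpi; ring. Qed.

Lemma cosB_pi x : cos (x - pi) = - cos x :> R.
Proof. by rewrite cosB cospi sinpi; ring. Qed.

(** The arctangent agrees at both ends, so only the linear term contributes. This gives the kernel
    its total mass 2 pi. *)
Lemma poisson_prim_pi r theta :
  poisson_prim r theta pi - poisson_prim r theta (- pi) = 2 * pi.
Proof.
rewrite /poisson_prim opprK sinDpi cosDpi sinB_pi cosB_pi; ring.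
Qed.

Lemma is_derive_sinBr (t0 t : R) : is_derive t 1 (fun u => sin (u - t0)) (cos (t - t0)).
Proof.
have -> : (fun u => sin (u - t0)) = (fun u => - sin (t0 - u)).
  by apply/funext => u; rewrite -sinN opprB.
have ? := is_derive_sinB t0 t; apply: is_derive_eq.
by rewrite opprK -cosN opprB.
Qed.

(* Integration by parts leaves \int cos (t - t0) P_r(theta - t), where
   2 r cos s P_r(s) = (1 + r^2) P_r(s) - (1 - r^2), and sin s P_r(s) is a
   logarithmic derivative. *)
Definition dpoisson_sin_prim r theta t0 t : R :=
  sin (t - t0) * poisson_kernel r (theta - t) -
  (cos (theta - t0) * ((1 + r ^+ 2) * poisson_prim r theta t - (1 - r ^+ 2) * t) -
   sin (theta - t0) * (1 - r ^+ 2) * ln (poisson_den r (theta - t))) / (2 * r).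

Lemma is_derive_dpoisson_sin_prim r theta t0 t : 0 < r < 1 ->
  is_derive t 1 (dpoisson_sin_prim r theta t0) (sin (t - t0) * dpoisson r theta t).
Proof.
move=> /andP[r0 r1]; have r01 : 0 <= r < 1 by rewrite ltW.
have D0 := poisson_den_gt0 (theta - t) r01.
have dln := @is_derive1_comp _ (@ln R) (fun u => poisson_den r (theta - u)) t _ _
  (is_derive1_ln D0)
  (is_derive_poisson_den r theta t).
have ? := is_derive_poisson_prim theta t r01.
have ? := is_derive_sinBr t0 t.
have ? := is_derive_poisson theta t r01.
rewrite /dpoisson_sin_prim; apply: is_derive_eq.
rewrite /GRing.scale/=.
(* Everything is expressed by sines and cosines of [theta - t] and [theta - t0], which leaves a
   rational identity. *)
have -> : t - t0 = (theta - t0) - (theta - t) by ring.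
rewrite (sinB (theta - t0)) (cosB (theta - t0)) /poisson_kernel /dpoisson.
move: D0; rewrite /poisson_den.
set c := cos (theta - t); set s := sin (theta - t).
set c0 := cos (theta - t0); set s0 := sin (theta - t0) => D0.
field.
by rewrite !lt0r_neq0.
Qed.

Lemma poisson_antiperiod r theta :
  poisson_kernel r (theta - - pi) = poisson_kernel r (theta - pi).
Proof. by rewrite opprK /poisson_kernel cosDpi cosB_pi. Qed.

(** Sine, kernel and logarithm agree at both ends. The linear growths leave 2 pi ((1 + r^2) - (1 -
    r^2)) / (2 r) = 2 pi r, times the cosine. *)
Lemma dpoisson_sin_prim_pi r theta t0 : 0 < r ->
  dpoisson_sin_prim r theta t0 pi - dpoisson_sin_prim r theta t0 (- pi) =
  - (2 * pi * (r * cos (theta - t0))).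
Proof.
move=> r0; rewrite /dpoisson_sin_prim poisson_antiperiod.
have -> : sin (- pi - t0) = sin (pi - t0).
  by rewrite sinB sinB sinN cosN sinpi; ring.
have -> : poisson_den r (theta - - pi) = poisson_den r (theta - pi).
  by rewrite opprK /poisson_den cosDpi cosB_pi.
have := poisson_prim_pi r theta.
move: (poisson_prim r theta pi) (poisson_prim r theta (- pi)) => p q pq.
have -> : p = q + 2 * pi by lra.
by field; rewrite lt0r_neq0.
Qed.

End poisson_kernel.

(** * The modulus and distances in polar form *)

Section modulus.
Context {R : realType}.
Implicit Types (z w : R[i]) (r x t theta : R).

Lemma modulusE z : modulus z = Num.sqrt (complex.Re z ^+ 2 + complex.Im z ^+ 2).
Proof. by rewrite /modulus normc_def. Qed.

Lemma norm_modulus z : `|z| = (modulus z)%:C.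
Proof. by rewrite modulusE normc_def. Qed.

Lemma modulusD z w : modulus (z + w) <= modulus z + modulus w.
Proof.
by rewrite -lecR rmorphD /= -!norm_modulus ler_normD.
Qed.

Lemma modulusB z w : modulus (z - w) = modulus (w - z).
Proof. by rewrite /modulus distrC. Qed.

Lemma modulus_ge0 z : 0 <= modulus z.
Proof. by rewrite modulusE sqrtr_ge0. Qed.

Lemma modulus_sub_polar r theta t :
  modulus (expi t - r%:C * expi theta) = Num.sqrt (poisson_den r (theta - t)).
Proof.
rewrite modulusE /expi /=; congr Num.sqrt; rewrite /poisson_den.
rewrite cosB !mul0r subr0 addr0.
transitivity ((cos t ^+ 2 + sin t ^+ 2) + r ^+ 2 * (cos theta ^+ 2 + sin theta ^+ 2)
  - 2 * r * (cos theta * cos t + sin theta * sin t)); first by ring.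
by rewrite !cos2Dsin2; ring.
Qed.

End modulus.

(** * Chords of the unit circle *)

Section chord.
Context {R : realType}.
Implicit Types (r x t theta : R).

(* The length |e^(ix) - 1| of a chord of the unit circle. *)
Definition chord x : R := Num.sqrt (poisson_den 1 x).

(** |1 - r e^(ix)|^2 is the sum of (1 - r cos x)^2 and (r sin x)^2. *)
Lemma poisson_den_ge_sin r x : (r * sin x) ^+ 2 <= poisson_den r x.
Proof.
rewrite /poisson_den -subr_ge0.
have -> : 1 - 2 * r * cos x + r ^+ 2 - (r * sin x) ^+ 2 = (1 - r * cos x) ^+ 2.
  rewrite [in LHS]exprMn sin2cos2; ring.
exact: sqr_ge0.
Qed.

Lemma poisson_den_ge0 r x : 0 <= poisson_den r x.
Proof. exact: le_trans (sqr_ge0 _) (poisson_den_ge_sin r x). Qed.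

Lemma sqrt_poisson_den_ge_sin r x : `|r * sin x| <= Num.sqrt (poisson_den r x).
Proof.
by rewrite -sqrtr_sqr ler_sqrt ?poisson_den_ge_sin ?poisson_den_ge0.
Qed.

Lemma chord_ge_sin x : `|sin x| <= chord x.
Proof. by rewrite -[sin x]mul1r; exact: sqrt_poisson_den_ge_sin. Qed.

(** The triangle inequality through the point r e^(i theta). *)
Lemma chord_triangle r theta t t0 : chord (t - t0) <=
  Num.sqrt (poisson_den r (theta - t)) + Num.sqrt (poisson_den r (theta - t0)).
Proof.
rewrite /chord -!modulus_sub_polar rmorph1 mul1r [leRHS]addrC.
rewrite [X in _ <= _ + X]modulusB.
have -> : expi t0 - expi t =
    (expi t0 - r%:C * expi theta) + (r%:C * expi theta - expi t).
  by rewrite addrA subrK.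
exact: modulusD.
Qed.

Lemma chordD2pi x : chord (x + 2 * pi) = chord x.
Proof. by rewrite /chord /poisson_den [2 * pi]mulr_natl cosD2pi. Qed.

Lemma continuous_chord : continuous chord.
Proof.
move=> x; apply: (@continuous_comp _ _ _ (poisson_den 1) Num.sqrt);
  last exact: sqrt_continuous.
rewrite /poisson_den; apply: cvgD; last exact: cvg_cst.
apply: cvgB; first exact: cvg_cst.
by apply: cvgM; [exact: cvg_cst|exact: continuous_cos].
Qed.

Lemma is_derive_approx (f : R -> R) x l e : is_derive x 1 f l -> 0 < e ->
  exists2 d, 0 < d & forall u, `|u| < d -> `|f (x + u) - f x - l * u| <= e * `|u|.
Proof.
move=> [fx <-] e0; move: fx; rewrite /derivable => /cvgrPdist_lt/(_ _ e0).
move=> /nbhs_ballP[d /= d0 dP]; exists d => // u ud.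
have [->|u0] := eqVneq u 0; first by rewrite addr0 subrr mulr0 subrr normr0 mulr0.
have := dP u; rewrite /ball /= sub0r normrN => /(_ ud u0).
rewrite -/(derive f x 1) => /ltW H.
have -> : f (x + u) - f x - 'D_1 f x * u =
    - (('D_1 f x - u^-1 *: (f (u *: (1 : R) + x) - f x)) * u).
  rewrite /GRing.scale /= mulr1 [u + x]addrC; field; exact: u0.
by rewrite normrN normrM ler_wpM2r.
Qed.

(** The sine has derivative 1 at 0, so |sin x| >= |x| / 2 near 0, and a chord is at least |sin
    x|. *)
Lemma chord_ge_lin : exists2 d : R, 0 < d & forall x, `|x| < d -> `|x| <= 2 * chord x.
Proof.
have h0 : 0 < 2^-1 :> R by [].
have [d d0 dP] := is_derive_approx (is_derive_sin (0 : R)) h0.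
exists d => // x /dP; rewrite add0r sin0 cos0 subr0 mul1r => sx.
have := chord_ge_sin x; have := ler_distD (sin x) x 0; rewrite !subr0 distrC; lra.
Qed.

(** Shifts by 2 pi carry [P] from [-(2n+1) pi, (2n+1) pi] to the next such interval, and these
    exhaust the line. *)
Lemma periodic_ind (P : R -> Prop) : (forall x, P x <-> P (x + 2 * pi)) ->
  (forall x, `|x| <= pi -> P x) -> forall x, P x.
Proof.
move=> P2 Ppi x; have pi0 := pi_gt0 R.
have : forall n : nat, forall x, `|x| <= n.*2.+1%:R * pi -> P x.
  elim=> [|n IH] {}x; first by rewrite mul1r; exact: Ppi.
  have -> : n.+1.*2.+1%:R * pi = n.*2.+1%:R * pi + 2 * pi :> R.
    by rewrite -mulrDl -natrD addn2 doubleS.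
  have : pi <= n.*2.+1%:R * pi :> R by rewrite ler_peMl ?ler1n// ltW.
  move: (n.*2.+1%:R * pi) IH => N IH piN; rewrite ler_norml => /andP[x1 x2].
  have [xpi|xpi] := leP pi x.
    rewrite -[x](subrK (2 * pi)); apply: (P2 _).1; apply: IH.
    by rewrite ler_norml; apply/andP; split; lra.
  have [xNpi|xNpi] := leP x (- pi).
    by apply: (P2 _).2; apply: IH; rewrite ler_norml; apply/andP; split; lra.
  by apply: Ppi; rewrite ler_norml; apply/andP; split; lra.
move=> /(_ (Num.bound `|x|)); apply.
apply: le_trans (ltW (archi_boundP (normr_ge0 x))) _.
have /ler_peMr : (1 : R) <= pi by have := pi_ge2 R; lra.
move=> /(_ (Num.bound `|x|).*2.+1%:R (ler0n _ _)); apply: le_trans.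
by rewrite ler_nat -addnn -addnS leq_addr.
Qed.

(** Near multiples of 2 pi the vanishing derivative gives the linear term; elsewhere the chord is
    bounded below and its fourth power absorbs [B]. The exponent 4 exceeds the order 3 of the
    singularity in the bound on the derivative of the kernel. *)
Lemma chord_bound (h : R -> R) (B e : R) :
  (forall x, h (x + 2 * pi) = h x) -> (forall x, `|h x| <= B) ->
  h 0 = 0 -> is_derive (0 : R) 1 h 0 -> 0 < e ->
  exists2 C, 0 <= C & forall x, `|h x| <= e * chord x + C * chord x ^+ 4.
Proof.
move=> hper hB h0 dh e0.
have [d1 d10 hd1] := is_derive_approx dh (divr_gt0 e0 (ltr0Sn R 1) : 0 < e / 2).
have [d2 d20 cd2] := chord_ge_lin.
(* The cap at [pi] keeps [d] where the cosine is decreasing. *)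
pose d := Num.min (Num.min d1 d2) pi.
have d0 : 0 < d by rewrite !lt_min d10 d20 pi_gt0.
have dpi : d <= pi by rewrite ge_min lexx orbT.
have B0 : 0 <= B := le_trans (normr_ge0 _) (hB 0).
(* The squared chord at [d], which is the least squared chord for [d <= |x| <= pi]. *)
pose k := 2 - 2 * cos d.
have k0 : 0 < k.
  have : cos d < cos 0 :> R.
    by rewrite ltr_cos ?in_itv/= ?lexx ?pi_ge0 ?dpi ?(ltW d0).
  rewrite cos0 /k; lra.
have C0 : 0 <= B / k ^+ 2 by rewrite divr_ge0// exprn_ge0// ltW.
exists (B / k ^+ 2) => //; apply: periodic_ind => [x|x xpi].
  by rewrite hper chordD2pi.
have ch0 : 0 <= chord x by exact: sqrtr_ge0.
have [xd|dx] := ltP `|x| d.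
  move: xd; rewrite !lt_min => /andP[/andP[/hd1 + /cd2 xc] _].
  rewrite add0r h0 subr0 mul0r subr0 => hx.
  have : e / 2 * `|x| <= e / 2 * (2 * chord x) by rewrite ler_wpM2l// divr_ge0// ltW.
  have : 0 <= B / k ^+ 2 * chord x ^+ 4 by rewrite mulr_ge0// exprn_ge0.
  lra.
have kc : k <= chord x ^+ 2.
  rewrite /chord sqr_sqrtr ?poisson_den_ge0// /poisson_den /k.
  have : cos x <= cos d.
    rewrite -[cos x]cos_norm leNgt ltr_cos ?in_itv/= ?normr_ge0 ?xpi ?dpi ?(ltW d0)//.
    by rewrite -leNgt.
  rewrite expr1n; lra.
apply: le_trans (hB x) _.
have : B <= B / k ^+ 2 * chord x ^+ 4.
  rewrite mulrAC ler_pdivlMr ?exprn_gt0// ler_wpM2l//.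
  by rewrite (exprM _ 2 2) lerXn2r ?nnegrE ?sqr_ge0// ltW.
have : 0 <= e * chord x by rewrite mulr_ge0// ltW.
lra.
Qed.

End chord.

(** * Pointwise estimate of the Poisson-Stieltjes integral *)

Section poisson_stieltjes_estimate.
Context {R : realType}.
Local Notation mu := (@lebesgue_measure R).
Implicit Types (r x t theta e C K l : R) (Phi : R -> R).

Lemma is_RS_integral_poisson Phi (M : R) r theta :
  periodic Phi (2 * pi) -> (forall x, `|Phi x| <= M) ->
  {ae mu, forall x, {for x, continuous Phi}} -> 0 <= r < 1 ->
  is_RS_integral (fun t => poisson_kernel r (theta - t)) Phi (- pi) pi
    (- \int[mu]_(t in `[- pi, pi]) (lower_envelope Phi t * dpoisson r theta t)).
Proof.
move=> Phiper PhiM Phic r01.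
have pipi : - pi <= pi :> R by have := pi_gt0 R; lra.
have := is_RS_integral_parts pipi PhiM Phic
  (fun t => is_derive_poisson theta t r01) (@continuous_dpoisson R r theta r01).
rewrite poisson_antiperiod (_ : Phi (- pi) = Phi pi) ?subrr ?sub0r//.
by rewrite -Phiper; congr Phi; ring.
Qed.

(** With q the square root of the denominator, |r sin (theta - t)| <= q cancels one power of the q^4
    below. *)
Lemma dpoisson_le r theta t : 0 <= r < 1 ->
  `|dpoisson r theta t| <=
    2 * (1 - r ^+ 2) / Num.sqrt (poisson_den r (theta - t)) ^+ 3.
Proof.
move=> r01; have D0 := poisson_den_gt0 (theta - t) r01.
have := sqrt_poisson_den_ge_sin r (theta - t).
rewrite /dpoisson -[in poisson_den _ _ ^+ 2](sqr_sqrtr (ltW D0)).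
have : 0 < Num.sqrt (poisson_den r (theta - t)) by rewrite sqrtr_gt0.
move: (Num.sqrt _) => q q0 rq.
have r2 : 0 <= 1 - r ^+ 2.
  by move/andP: r01 => [r0 r1]; rewrite subr_ge0 expr_le1// ltW.
rewrite !normrM normfV (ger0_norm r2) normrX (ger0_norm (sqr_ge0 q)).
rewrite ler_pdivrMr ?exprn_gt0//.
have -> : 2 * (1 - r ^+ 2) / q ^+ 3 * q ^+ 2 ^+ 2 = (1 - r ^+ 2) * (2 * q).
  by field; rewrite lt0r_neq0.
rewrite ler_wpM2l// -mulrA -normrM ger0_norm// ler_wpM2l//.
Qed.

Lemma chord_dpoisson_le r theta t t0 e C K : 0 <= r < 1 -> 0 <= e -> 0 <= C ->
  0 <= K -> Num.sqrt (poisson_den r (theta - t0)) <= K * (1 - r) ->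
  (e * chord (t - t0) + C * chord (t - t0) ^+ 4) * `|dpoisson r theta t| <=
  2 * e * (1 + K) * poisson_kernel r (theta - t) +
  4 * C * (1 + K) ^+ 4 * (1 - r ^+ 2).
Proof.
move=> r01 e0 C0 K0 dK; have /andP[r0 r1] := r01.
have D0 := poisson_den_gt0 (theta - t) r01.
have := dpoisson_le theta t r01.
have := chord_triangle r theta t t0.
have : 0 <= chord (t - t0) by exact: sqrtr_ge0.
have : 1 - r <= Num.sqrt (poisson_den r (theta - t)).
  have r1' : 0 <= 1 - r by rewrite subr_ge0 ltW.
  by rewrite -(ger0_norm r1') -sqrtr_sqr ler_sqrt ?poisson_den_ge// ltW.
have : Num.sqrt (poisson_den r (theta - t)) <= 2.
  rewrite -[leRHS]ger0_norm// -sqrtr_sqr ler_sqrt ?sqr_ge0// /poisson_den.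
  have := ler_wpM2l r0 (cos_geN1 (theta - t)).
  have : r ^+ 2 <= 1 by rewrite expr_le1// ltW.
  lra.
have -> : poisson_kernel r (theta - t) =
    (1 - r ^+ 2) / Num.sqrt (poisson_den r (theta - t)) ^+ 2.
  by rewrite sqr_sqrtr// ltW.
have : 0 < Num.sqrt (poisson_den r (theta - t)) by rewrite sqrtr_gt0.
move: (Num.sqrt (poisson_den r (theta - t))) (chord _) => q c q0 q2 rq c0 cq dq.
have r2 : 0 <= 1 - r ^+ 2 by rewrite subr_ge0 expr_le1// ltW.
have cKq : c <= (1 + K) * q.
  have := ler_wpM2l K0 rq; lra.
have c4 : c ^+ 4 <= ((1 + K) * q) ^+ 4.
  by rewrite lerXn2r// nnegrE// (le_trans c0).
apply: (@le_trans _ _ ((e * ((1 + K) * q) + C * ((1 + K) * q) ^+ 4) *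
    (2 * (1 - r ^+ 2) / q ^+ 3))).
  apply: ler_pM => //.
    by rewrite addr_ge0// mulr_ge0// exprn_ge0.
  by apply: lerD; exact: ler_wpM2l.
(* The linear term over q^3 becomes the kernel; the quartic term leaves one factor q, which is at
   most 2. *)
have -> : (e * ((1 + K) * q) + C * ((1 + K) * q) ^+ 4) *
    (2 * (1 - r ^+ 2) / q ^+ 3) =
  2 * e * (1 + K) * ((1 - r ^+ 2) / q ^+ 2) +
  (2 * C * (1 + K) ^+ 4 * (1 - r ^+ 2)) * q.
  by field; rewrite lt0r_neq0.
rewrite lerD2l.
have -> : 4 * C * (1 + K) ^+ 4 * (1 - r ^+ 2) =
  (2 * C * (1 + K) ^+ 4 * (1 - r ^+ 2)) * 2 by ring.
apply: ler_wpM2l => //; by do !apply: mulr_ge0 => //; exact: addr_ge0.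
Qed.

Lemma continuous_poisson_kernel r theta : 0 <= r < 1 ->
  continuous (fun t => poisson_kernel r (theta - t)).
Proof.
move=> r01 t; apply: differentiable_continuous; apply/derivable1_diffP.
by have [] := is_derive_poisson theta t r01.
Qed.

Lemma poisson_stieltjes_estimate Phi (M : R) r theta t0 l e C K :
  periodic Phi (2 * pi) -> (forall x, `|Phi x| <= M) ->
  {ae mu, forall x, {for x, continuous Phi}} -> 0 < r < 1 ->
  0 <= e -> 0 <= C -> 0 <= K ->
  Num.sqrt (poisson_den r (theta - t0)) <= K * (1 - r) ->
  (forall t, `|Phi t - (Phi t0 + l * sin (t - t0))| <=
    e * chord (t - t0) + C * chord (t - t0) ^+ 4) ->
  `|(2 * pi)^-1 *
      RS_integral (fun t => poisson_kernel r (theta - t)) Phi (- pi) pi -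
    l * (r * cos (theta - t0))| <=
  2 * e * (1 + K) + 4 * C * (1 + K) ^+ 4 * (1 - r ^+ 2).
Proof.
move=> Phiper PhiM Phic r01' e0 C0 K0 dK Phiu; have /andP[r0 r1] := r01'.
have r01 : 0 <= r < 1 by rewrite ltW.
have pi0 := pi_gt0 R.
have pipi : - pi <= pi :> R by lra.
rewrite (RS_integralE pipi (is_RS_integral_poisson theta Phiper PhiM Phic r01)).
pose u t := Phi t0 + l * sin (t - t0).
pose v t := e * chord (t - t0) + C * chord (t - t0) ^+ 4.
have cB : continuous (fun t => t - t0 : R).
  by move=> t; apply: cvgB; [exact: cvg_id|exact: cvg_cst].
have cu : continuous u.
  move=> t; apply: cvgD; first exact: cvg_cst.
  apply: cvgM; first exact: cvg_cst.
  exact: continuous_comp (cB t) (@continuous_sin _ _).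
have cch : continuous (fun t => chord (t - t0)).
  by move=> t; exact: continuous_comp (cB t) (@continuous_chord _ _).
have cv : continuous v.
  move=> t; apply: cvgD; (apply: cvgM; first exact: cvg_cst).
    exact: cch.
  apply: (@continuous_comp _ _ _ (fun t => chord (t - t0)) (fun x => x ^+ 4)).
    exact: cch.
  exact: exprn_continuous.
have env t : `|lower_envelope Phi t - u t| <= v t.
  exact: lower_envelope_dist PhiM cu cv Phiu.
pose dp := dpoisson r theta.
have cdp : continuous dp := @continuous_dpoisson R r theta r01.
have iE : mu.-integrable `[- pi, pi] (EFin \o (lower_envelope Phi \* dp)).
  apply: (integrable_bounded_mul _ _ (measurable_lower_envelope PhiM) _ cdp).
  by move=> x; exact: lower_envelope_norm.
have cudp : continuous (u \* dp) by move=> t; apply: cvgM; [exact: cu|exact: cdp].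
have iu : mu.-integrable `[- pi, pi] (EFin \o (u \* dp)).
  exact: continuous_integrable_itv.
(* The constant [Phi t0] contributes nothing, as the kernel agrees at both ends. *)
have intu : \int[mu]_(t in `[- pi, pi]) (u t * dp t) =
    - (2 * pi * (l * (r * cos (theta - t0)))).
  have dU (t : R) : is_derive t 1 (fun t => Phi t0 * poisson_kernel r (theta - t) +
      l * dpoisson_sin_prim r theta t0 t) (u t * dp t).
    have ? := is_derive_poisson theta t r01.
    have ? := is_derive_dpoisson_sin_prim theta t0 t r01'.
    by apply: is_derive_eq; rewrite /GRing.scale/= /u /dp; ring.
  rewrite (Rintegral_derive pipi dU cudp).
  have := dpoisson_sin_prim_pi theta t0 r0; rewrite poisson_antiperiod.
  move: (dpoisson_sin_prim r theta t0 pi) (dpoisson_sin_prim r theta t0 (- pi)).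
  by move=> p q pq; rewrite (_ : p = q - 2 * pi * (r * cos (theta - t0))); [ring|lra].
pose w t := 2 * e * (1 + K) * poisson_kernel r (theta - t) +
  4 * C * (1 + K) ^+ 4 * (1 - r ^+ 2).
have cw : continuous w.
  move=> t; apply: cvgD; last exact: cvg_cst.
  by apply: cvgM; [exact: cvg_cst|exact: continuous_poisson_kernel].
have intw : \int[mu]_(t in `[- pi, pi]) w t =
    2 * pi * (2 * e * (1 + K) + 4 * C * (1 + K) ^+ 4 * (1 - r ^+ 2)).
  have dW (t : R) : is_derive t 1 (fun t =>
      2 * e * (1 + K) * poisson_prim r theta t +
      4 * C * (1 + K) ^+ 4 * (1 - r ^+ 2) * t) (w t).
    have ? := is_derive_poisson_prim theta t r01.
    by apply: is_derive_eq; rewrite /GRing.scale/= /w; ring.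
  rewrite (Rintegral_derive pipi dW cw).
  have := poisson_prim_pi r theta.
  move: (poisson_prim r theta pi) (poisson_prim r theta (- pi)) => p q pq.
  have -> : p = q + 2 * pi by lra.
  ring.
have diff : \int[mu]_(t in `[- pi, pi]) (lower_envelope Phi t * dp t - u t * dp t) =
  \int[mu]_(t in `[- pi, pi]) (lower_envelope Phi t * dp t) +
    2 * pi * (l * (r * cos (theta - t0))).
  by rewrite RintegralB// intu opprK.
have le : `|\int[mu]_(t in `[- pi, pi]) (lower_envelope Phi t * dp t - u t * dp t)| <=
    \int[mu]_(t in `[- pi, pi]) w t.
  have iB : mu.-integrable `[- pi, pi]
      (EFin \o (fun t => lower_envelope Phi t * dp t - u t * dp t)).
    exact: integrableB iE iu.
  apply: le_trans (le_normr_Rintegral _ iB) _ => //.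
  apply: le_Rintegral => //.
  - exact: integrable_norm.
  - exact: continuous_integrable_itv.
  - move=> t _; rewrite -mulrBl normrM.
    apply: le_trans (chord_dpoisson_le t r01 e0 C0 K0 dK).
    by rewrite ler_wpM2r.
move: le; rewrite diff intw.
set I := Rintegral _ _ _ => le.
rewrite (_ : _ - _ = - ((2 * pi)^-1 * (I + 2 * pi * (l * (r * cos (theta - t0)))))).
  have pi2 : 0 < 2 * pi :> R by rewrite mulr_gt0.
  by rewrite normrN normrM normfV (gtr0_norm pi2) ler_pdivrMl.
by clearbody I; move: (@pi R) pi0 => p p0; field; rewrite lt0r_neq0.
Qed.

End poisson_stieltjes_estimate.

(** * Nontangential approach *)

Section argument.
Context {R : realType}.
Implicit Types (z : R[i]) (t s : R).

Lemma modulus_sqr z : modulus z ^+ 2 = complex.Re z ^+ 2 + complex.Im z ^+ 2.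
Proof. by rewrite modulusE sqr_sqrtr// addr_ge0 ?sqr_ge0. Qed.

Lemma modulus_expi t : modulus (expi t) = 1.
Proof. by rewrite modulusE /= cos2Dsin2 sqrtr1. Qed.

(** [acos x] has sine |y|, so the sign of [y] decides between [acos x] and its opposite. *)
Lemma polar_exists (x y : R) : x ^+ 2 + y ^+ 2 = 1 ->
  exists t, [/\ t \in `]- pi, pi], cos t = x & sin t = y].
Proof.
move=> xy; have pi0 := pi_gt0 R.
have x1 : -1 <= x <= 1.
  rewrite -ler_norml -ler_sqr ?nnegrE// real_normK ?num_real// expr1n.
  by have := sqr_ge0 y; lra.
have sx : Num.sqrt (1 - x ^+ 2) = `|y|.
  by rewrite -sqrtr_sqr; congr Num.sqrt; lra.
have xi : x \in `[(-1), 1] by rewrite in_itv.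
have [y0|y0] := leP 0 y.
  exists (acos x); rewrite acosK// sin_acos// sx ger0_norm//; split=> //.
  rewrite in_itv/= acos_lepi// andbT (lt_le_trans _ (acos_ge0 x1))//; lra.
exists (- acos x); rewrite cosN acosK// sinN sin_acos// sx ltr0_norm// opprK; split=> //.
rewrite in_itv/= ltrN2; apply/andP; split.
  (* The excluded endpoint [- pi] is avoided: [x = -1] would force [y = 0], against [y < 0]. *)
  apply: acos_ltpi; have /andP[] := x1; rewrite le_eqVlt => /predU1P[xN1|-> ->//] _.
  move: xy; rewrite -xN1 sqrrN expr1n => h.
  have : y ^+ 2 == 0 by apply/eqP; lra.
  by rewrite sqrf_eq0 lt_eqF.
by have := acos_ge0 x1; lra.
Qed.

Lemma cargP z : carg z \in `]- pi, pi] /\ z = (modulus z)%:C * expi (carg z).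
Proof.
suff : exists t, t \in `]- pi, pi] /\ z = (modulus z)%:C * expi t.
  by move=> /xgetPex; apply.
have [m0|m0] := eqVneq (modulus z) 0.
  exists 0; split; first by rewrite in_itv/= oppr_lt0 pi_gt0 pi_ge0.
  by rewrite m0 mul0r; apply/eqP; rewrite -normr_eq0 norm_modulus m0.
have [|t [tpi ct st]] := @polar_exists (complex.Re z / modulus z) (complex.Im z / modulus z).
  by rewrite !expr_div_n -mulrDl -modulus_sqr divff// expf_neq0.
exists t; split => //; rewrite /expi ct st.
case: z m0 {ct st} => x y m0; apply/eqP; rewrite eq_complex /= !mul0r subr0 addr0.
by rewrite 2![modulus _ * _]mulrC !divfK ?eqxx.
Qed.

(** Equal cosines give |t| = |s|. If t = -s, equal sines give sin s = 0, hence s = 0, because both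
    [s] and [- s] exceed [- pi]. *)
Lemma expi_inj t s : t \in `]- pi, pi] -> s \in `]- pi, pi] ->
  expi t = expi s -> t = s.
Proof.
rewrite !in_itv/= => /andP[t1 t2] /andP[s1 s2] [cts sts].
have absi (u : R) : - pi < u -> u <= pi -> `|u| \in `[0, pi].
  by move=> u1 u2; rewrite in_itv/= normr_ge0 ler_norml ltW.
have : `|t| = `|s|.
  by apply: cos_inj; rewrite ?absi// !cos_norm.
move=> /eqP; rewrite eqr_norm2 => /predU1P[//|/eqP tNs].
have st0 : sin s = 0 by move: sts; rewrite tNs sinN; lra.
have [s0|s0|s0] := ltgtP s 0; last by rewrite tNs s0 oppr0.
  have : 0 < sin (- s) by apply: sin_gt0_pi; apply/andP; split; lra.
  by rewrite sinN st0 oppr0 ltxx.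
have : 0 < sin s by apply: sin_gt0_pi; apply/andP; split; lra.
by rewrite st0 ltxx.
Qed.

Lemma carg_expi t : t \in `]- pi, pi] -> carg (expi t) = t.
Proof.
move=> tpi; have [cpi] := cargP (expi t).
rewrite modulus_expi rmorph1 mul1r => zE; apply: expi_inj => //; exact: esym zE.
Qed.

Lemma modulus_sub_expi z t :
  modulus (z - expi t) = Num.sqrt (poisson_den (modulus z) (carg z - t)).
Proof. by rewrite modulusB -modulus_sub_polar -(cargP z).2. Qed.

End argument.

Section nontangential.
Context {R : realType}.
Implicit Types (z zeta : R[i]) (gamma : R -> R[i]).

Lemma nbhs_modulus zeta (N : set R[i]) : nbhs (zeta : R[i]^o) N ->
  exists2 d : R, 0 < d & forall z, modulus (z - zeta) < d -> N z.
Proof.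
(* A positive element of [R[i]] has zero imaginary part, so the radius is the real number [e1]. *)
move=> /nbhs_ballP[[e1 e2] /=]; rewrite ltcE /= => /andP[/eqP -> e0] eN.
exists e1 => // z zd; apply: eN; rewrite /ball /= norm_modulus modulusB.
by rewrite ltcE /= eqxx.
Qed.

(** The angle lies in the disc up to distance [p] from its vertex, so its directions stay uniformly
    away from the tangent. The end of the path therefore lies in a Stolz region. *)
Lemma nontangential_stolz t0 gamma : nontangential (expi t0) gamma ->
  exists2 K : R, 0 <= K & forall d : R, 0 < d ->
    \forall s \near (1 : R)^'-, [/\ modulus (gamma s) < 1,
      modulus (gamma s - expi t0) < d
    & modulus (gamma s - expi t0) <= K * (1 - modulus (gamma s))].
Proof.
move=> [[_ gD gl] [alpha [beta [N [Nz aN gN]]]]].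
have [p p0 pN] := nbhs_modulus Nz.
(* With m the modulus and rho the distance to the vertex, this is the 2 of 1 - m^2 <= 2 (1 - m)
   divided by the lower bound p / 4 for (1 - m^2) / rho. *)
exists (8 / p); first by rewrite divr_ge0// ltW.
move=> d d0.
have m0 : 0 < Num.min d (p / 4) by rewrite lt_min d0 divr_gt0.
have /cvgrPdist_lt/(_ (Num.min d (p / 4))%:C) :
  (gamma s : R[i]^o) @[s --> (1 : R)^'-] --> (expi t0 : R[i]^o) := gl.
rewrite ltcR => /(_ m0) glim.
near=> s.
have sd : modulus (gamma s - expi t0) < Num.min d (p / 4).
  by rewrite -ltcR -norm_modulus distrC; near: s.
have s01 : `[0, 1[%classic s.
  rewrite /= in_itv/=; apply/andP; split; near: s.
    exact: nbhs_left_ge.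
  exact: nbhs_left_lt.
have gs1 : modulus (gamma s) < 1 by apply: gD; exists s.
move: sd; rewrite lt_min => /andP[sd sp]; split => //.
have [|rho [phi [rho0 phiab gE]]] := gN (gamma s).
  by split; [exists s|apply: pN; apply: lt_trans sp _; lra].
have polar (x : R) : modulus (expi t0 + x%:C * expi phi) ^+ 2 =
    1 + 2 * x * cos (phi - t0) + x ^+ 2.
  have := modulus_sub_polar (- x) phi t0.
  rewrite rmorphN mulNr opprK => ->; rewrite sqr_sqrtr ?poisson_den_ge0//.
  by rewrite /poisson_den; ring.
have dist (x : R) : 0 <= x -> modulus (expi t0 + x%:C * expi phi - expi t0) = x.
  move=> x0; rewrite addrC addKr modulusE /= !mul0r subr0 addr0 !exprMn.
  by rewrite -mulrDr cos2Dsin2 mulr1 sqrtr_sqr ger0_norm.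
(* The point at distance p / 2 on the ray of gamma s still lies in the disc,
   which bounds the cosine away from 0 uniformly in s. *)
have cphi : p / 2 < - (2 * cos (phi - t0)).
  have p20 : 0 < p / 2 by rewrite divr_gt0.
  have : modulus (expi t0 + (p / 2)%:C * expi phi) < 1.
    apply: aN; split; first by exists (p / 2), phi.
    by apply: pN; rewrite dist ?ltW//; lra.
  rewrite -ltr_sqr ?nnegrE ?modulus_ge0// polar expr1n.
  have -> : 1 + 2 * (p / 2) * cos (phi - t0) + (p / 2) ^+ 2 =
    1 + (p / 2) * (2 * cos (phi - t0) + p / 2) by ring.
  by rewrite gtrDl pmulr_rlt0//; lra.
move: gs1 sp; rewrite gE (dist _ (ltW rho0)) => gs1 sp.
have := polar rho; have := modulus_ge0 (expi t0 + rho%:C * expi phi).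
move: gs1; move: (modulus _) => m m1 m0' mE.
rewrite mulrAC ler_pdivlMr//.
(* The right side is 1 - m^2; since [rho < p / 4], at least p / 4 remains of the p / 2 from
   [cphi]. *)
have : rho * (p / 4) <= rho * (- (2 * cos (phi - t0)) - rho).
  by rewrite ler_wpM2l ?ltW//; lra.
have : (1 - m) * (1 + m) <= (1 - m) * 2 by rewrite ler_wpM2l ?subr_ge0 ?ltW//; lra.
lra.
Unshelve. all: by end_near. Qed.

End nontangential.

(** * Convergence at points of differentiability *)

Section fatou.
Context {R : realType}.
Local Notation mu := (@lebesgue_measure R).
Implicit Types (Phi : R -> R) (gamma : R -> R[i]).

(** Using [sin] for the linear term keeps the remainder [h] periodic, while its value and derivative
    at 0 still vanish. *)
Lemma derivable_chord_bound Phi (M t0 l e : R) :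
  periodic Phi (2 * pi) -> (forall x, `|Phi x| <= M) ->
  is_derive t0 (1 : R) Phi l -> 0 < e ->
  exists2 C, 0 <= C & forall t, `|Phi t - (Phi t0 + l * sin (t - t0))| <=
    e * chord (t - t0) + C * chord (t - t0) ^+ 4.
Proof.
move=> Phiper PhiM dPhi e0.
pose h x := Phi (x + t0) - (Phi t0 + l * sin x).
have [|||||C C0 hC] := @chord_bound _ h (M + (M + `|l|)) e.
- move=> x; rewrite /h [2 * pi]mulr_natl sinD2pi -[pi *+ 2]mulr_natl.
  by rewrite addrAC Phiper.
- move=> x; apply: le_trans (ler_normB _ _) _; apply: lerD => //.
  apply: le_trans (ler_normD _ _) _; apply: lerD => //.
  by rewrite normrM ler_piMr// sin_max.
- by rewrite /h add0r sin0 mulr0 addr0 subrr.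
- have dsh := is_derive_shift (0 : R) (1 : R) t0.
  have d0 : is_derive (0 + t0) (1 : R) Phi l by rewrite add0r.
  have dc := @is_derive1_comp _ Phi (shift t0) 0 _ _ d0 dsh.
  by apply: is_derive_eq; rewrite cos0 /GRing.scale/=; ring.
- by [].
by exists C => // t; have := hC (t - t0); rewrite /h subrK.
Qed.

Lemma poisson_stieltjes_nontangential_cvg Phi (M t0 l : R) gamma :
  periodic Phi (2 * pi) -> (forall x, `|Phi x| <= M) ->
  {ae mu, forall x, {for x, continuous Phi}} -> is_derive t0 (1 : R) Phi l ->
  nontangential (expi t0) gamma ->
  poisson_stieltjes Phi (gamma s) @[s --> (1 : R)^'-] --> l.
Proof.
move=> Phiper PhiM Phic dPhi /nontangential_stolz[K K0 gK].
apply/cvgrPdist_lt => eps eps0.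
have K1 : 0 < 1 + K by rewrite ltr_pwDl.
(* Chosen so that the main term [2 * e * (1 + K)] of the estimate equals [eps / 2]. *)
have e0 : 0 < eps / (4 * (1 + K)) by rewrite divr_gt0// mulr_gt0.
have [C C0 PhiC] := derivable_chord_bound Phiper PhiM dPhi e0.
have K4 : 0 <= (1 + K) ^+ 4 by rewrite exprn_ge0// ltW.
(* Collects the errors proportional to the distance d from the boundary point: the first term comes
   from 1 - r^2 <= 2 d, [|l|] from replacing r cos (theta - t0) by 1, and the last 1 makes [A]
   positive. *)
pose A := 8 * C * (1 + K) ^+ 4 + `|l| + 1.
have A0 : 0 < A.
  by rewrite ltr_wpDl// addr_ge0// mulr_ge0// mulr_ge0.
(* The bound 1 forces [r > 0], needed for the primitive divided by [2 * r]. *)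
have d0 : 0 < Num.min (eps / (2 * A)) 1 by rewrite lt_min ltr01 divr_gt0// mulr_gt0.
apply: filterS (gK _ d0) => s [].
rewrite modulus_sub_expi lt_min.
set r := modulus _; set theta := carg _; set d := Num.sqrt _.
move=> r1 /andP[dA d1] dK.
have r0' : 0 <= r by exact: modulus_ge0.
have rd : 1 - r <= d.
  have r1' : 0 <= 1 - r by rewrite subr_ge0 ltW.
  by rewrite -(ger0_norm r1') -sqrtr_sqr ler_sqrt ?poisson_den_ge// poisson_den_ge0.
have r0 : 0 < r by lra.
have r01 : 0 < r < 1 by rewrite r0.
have := poisson_stieltjes_estimate Phiper PhiM Phic r01 (ltW e0) C0 K0 dK PhiC.
rewrite -[X in `|X - _|]/(poisson_stieltjes Phi (gamma s)).
have -> : 2 * (eps / (4 * (1 + K))) * (1 + K) = eps / 2.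
  by field; rewrite lt0r_neq0.
(* The real part of 1 - r e^(i (theta - t0)) is at most its modulus, which is [d]. *)
have cosd : `|1 - r * cos (theta - t0)| <= d.
  rewrite -sqrtr_sqr ler_sqrt ?poisson_den_ge0// -subr_ge0.
  have -> : poisson_den r (theta - t0) - (1 - r * cos (theta - t0)) ^+ 2 =
      (r * sin (theta - t0)) ^+ 2.
    by rewrite /poisson_den exprMn sin2cos2; ring.
  exact: sqr_ge0.
have ld : `|l - l * (r * cos (theta - t0))| <= `|l| * d.
  by rewrite -[X in X - _]mulr1 -mulrBr normrM ler_wpM2l.
have r2 : 4 * C * (1 + K) ^+ 4 * (1 - r ^+ 2) <= 8 * C * (1 + K) ^+ 4 * d.
  have -> : 8 * C * (1 + K) ^+ 4 * d = 4 * C * (1 + K) ^+ 4 * (2 * d) by ring.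
  rewrite ler_wpM2l//; first by rewrite mulr_ge0// mulr_ge0.
  have : (1 - r) * (1 + r) <= (1 - r) * 2 by rewrite ler_wpM2l ?subr_ge0 ?(ltW r1)//; lra.
  lra.
have dAe : d * A < eps / 2.
  by move: dA; rewrite invfM mulrA ltr_pdivlMr.
have dge : 0 <= d by exact: sqrtr_ge0.
move: dAe; rewrite /A !mulrDr mulr1 => dAe est.
apply: le_lt_trans (ler_distD (l * (r * cos (theta - t0))) _ _) _.
rewrite [X in _ + X]distrC; lra.
Qed.

End fatou.

(** [RS_integral] and [derive1] take a value even where no integral or derivative exists, so
    integrability and differentiability are asserted along with the limit. *)
Theorem corollary2 (R : realType) (Phi : R -> R)
    (Phi_periodic : periodic Phi (2 * pi))
    (Phi_bounded : bounded_fun Phi)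
    (Phi_derivable : {ae (@lebesgue_measure R), forall t, derivable Phi t 1}) :
  (forall z : R[i], unit_disc z ->
     RS_integrable (poisson_at z) Phi (- pi) pi) /\
  circle_ae (fun zeta : R[i] =>
    derivable Phi (carg zeta) 1 /\
    forall gamma : R -> R[i], nontangential zeta gamma ->
      poisson_stieltjes Phi (gamma s) @[s --> (1 : R)^'-]
        --> derive1 Phi (carg zeta)).
Proof.
have [M PhiM] : exists M : R, forall x, `|Phi x| <= M.
  case: Phi_bounded => M [_ PhiM]; exists (M + 1) => x.
  by apply: PhiM => //; rewrite ltrDl.
have Phi_cont : {ae (@lebesgue_measure R), forall x, {for x, continuous Phi}}.
  apply: (@filterS _ _ (ae_filter_ringOfSetsType _) _ _ _ Phi_derivable) => x Phix.
  by apply: differentiable_continuous; apply/derivable1_diffP.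
split=> [z z1|].
  have r01 : 0 <= modulus z < 1 by rewrite modulus_ge0.
  by eexists; exact: is_RS_integral_poisson Phi_periodic PhiM Phi_cont r01.
apply: (@filterS _ _ (ae_filter_ringOfSetsType _) _ _ _ Phi_derivable) => t Phit tpi.
rewrite (carg_expi tpi); split=> [|gamma]; first exact: Phit.
apply: (poisson_stieltjes_nontangential_cvg Phi_periodic PhiM Phi_cont).
by rewrite derive1E; exact: derivableP.
Qed.
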